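(* Let $Q=\{(x,y)\in[0,1]^n\times[0,1]^n\mid\sum_{i=1}^n a_ix_iy_i\ge d\}$, with $d\in\mathbb{R}$ and $a_i\in\mathbb{R}$ for $i\in[n]$, and let $\Lambda=\{I,J_0,J_1\}$ be a minimal cover yielding partition for $Q$. Let $d^\Lambda:=d-\sum_{i\in J_1}a_i$, $\Delta:=\sum_{i\in I}a_i-d^\Lambda$, $d_i:=a_i-\Delta$, $I^>:=\{i\in I\mid a_i>\Delta\}$ and, when $I^>\ne\emptyset$, let $i_0\in I^>$ be any index with $a_{i_0}=\min\{a_i\mid i\in I^>\}$. Let $l_-=\frac1\Delta$, and let $l_+=\frac{\sqrt{a_{i_0}}+\sqrt{d_{i_0}}}{\Delta\sqrt{d_{i_0}}}$ if $I^>\neq\emptyset$ and $l_+=\frac1\Delta$ otherwise. Let $J_0^+=\{i\in J_0\mid a_i>0\}$, $J_0^-=\{i\in J_0\mid a_i<0\}$, $J_1^+=\{i\in J_1\mid a_i>0\}$, $J_1^-=\{i\in J_1\mid a_i<0\}$. Then the lifted bilinear cover inequality $$\sum_{i\in I}\frac{\sqrt{a_i}}{\sqrt{a_i}-\sqrt{d_i}}\left(\sqrt{x_iy_i}-1\right)+\sum_{i\notin I}\gamma_i(x_i,y_i)\ge-1$$ is valid for $Q$ (satisfied by every $(x,y)\in Q$), where the $\gamma_i:[0,1]^2\to\mathbb{R}$, for $i\in[n]\setminus I$, are the concave functions: (i) $\gamma_i(x,y)=l_+a_i\min\{x,y\}$ for $i\in J_0^+$; (ii) $\gamma_i(x,y)=-l_+a_i\min\{2-x-y,1\}$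 for $i\in J_1^-$; (iii) $\gamma_i(x,y)=\min\{l_-a_i(x+y-1),\ l_+a_i(x+y-1)+l_+\Delta-1,\ 0\}$ for $i\in J_0^-$; (iv) $\gamma_i(x,y)=\min\{\tilde g_i(x,y),\tilde h_i(x,y),g_i(x,y),h_i(x,y)\}$ for $i\in J_1^+$ with $a_i\ge a_{i_0}$ when $I^>\ne\emptyset$, and $\gamma_i(x,y)=\min\{\tilde g_i(x,y),\tilde h_i(x,y)\}$ in all other cases where $i\in J_1^+$, with $$\tilde g_i(x,y)=l_+a_i(\min\{x,y\}-1)+l_+\Delta-1,$$ $$\tilde h_i(x,y)=l_-a_i(\min\{x,y\}-1),$$ $$g_i(x,y)=\sqrt{a_i-\Delta}\,\sqrt{a_i}\,l_+\sqrt{xy}-l_+(a_i-\Delta)-1,$$ $$h_i(x,y)=\frac{\sqrt{a_i}}{\sqrt{a_i}-\sqrt{d_i}}(\sqrt{xy}-1);$$ and $\gamma_i\equiv0$ for $i\notin I$ with $a_i=0$.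
   Context: $[n]=\{1,\dots,n\}$. Real numbers $a_i$, $i\in I$ (with $I$ a nonempty finite index set), form a minimal cover of $d'\in\mathbb{R}$ if (i) $a_i>0$ for all $i\in I$ and $d'>0$, (ii) $\sum_{i\in I}a_i>d'$, and (iii) $\sum_{i\in K}a_i\le d'$ for every proper subset $K\subsetneq I$. A partition $\Lambda=\{I,J_0,J_1\}$ of $[n]$ (i.e., $I\cup J_0\cup J_1=[n]$, pairwise disjoint) with $I\ne\emptyset$ is a minimal cover yielding partition for $Q$ if the numbers $a_i$, $i\in I$, form a minimal cover of $d^\Lambda=d-\sum_{i\in J_1}a_i$. (Consequently $\Delta>0$ and $d_i=a_i-\Delta\ge0$ for $i\in I$.) *)

(* Defs.v *)
From HB Require Import structures.
From mathcomp Require Import all_boot all_order all_algebra.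
From mathcomp Require Import all_classical all_reals all_analysis.
Set Implicit Arguments.
Unset Strict Implicit.
Unset Printing Implicit Defensive.
Import Order.TTheory GRing.Theory Num.Theory.
Local Open Scope ring_scope.

Definition minimal_cover (R : realType) (T : finType) (I : {set T})
    (a : T -> R) (d : R) : Prop :=
  [/\ I != finset.set0,
      (forall i, i \in I -> 0 < a i) /\ 0 < d,
      d < \sum_(i in I) a i
    & forall K : {set T}, K \proper I -> \sum_(i in K) a i <= d].

Definition unit_square (R : realType) : set (R * R) :=
  (`[0, 1] `*` `[0, 1])%classic.

Definition concave_function (R : realType) (E : lmodType R)
    (D : set (convex_lmodType E)) (f : convex_lmodType E -> R^o) : Prop :=
  convex_function D (fun p => - f p).

Section LiftedBilinearCover.
Context (R : realType) (n : nat) (a : 'I_n -> R) (d : R).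

Definition bilinear_cover_set : set (('I_n -> R) * ('I_n -> R)) :=
  [set p | (forall i, unit_square (p.1 i, p.2 i)) /\
           d <= \sum_i a i * p.1 i * p.2 i]%classic.

Context (I J0 J1 : {set 'I_n}).

Definition dLambda : R := d - \sum_(i in J1) a i.

(* The blocks J0 and J1 may be empty, so [finset.partition] does not apply. *)
Definition minimal_cover_yielding_partition : Prop :=
  [/\ I :|: J0 :|: J1 = [set: 'I_n],
      [/\ [disjoint I & J0], [disjoint I & J1] & [disjoint J0 & J1]],
      I != finset.set0
    & minimal_cover I a dLambda].

Definition Delta : R := \sum_(i in I) a i - dLambda.

Definition d_ (i : 'I_n) : R := a i - Delta.

Definition Igt : {set 'I_n} := [set i in I | Delta < a i].

Definition pos_part (J : {set 'I_n}) : {set 'I_n} := [set i in J | 0 < a i].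
Definition neg_part (J : {set 'I_n}) : {set 'I_n} := [set i in J | a i < 0].

(* An index minimizing [a] over [Igt]; no constraint when [Igt] is empty, in
   which case the definitions below do not depend on [i0]. *)
Definition min_index (i0 : 'I_n) : Prop :=
  Igt != finset.set0 -> i0 \in Igt /\ forall i, i \in Igt -> a i0 <= a i.

Context (i0 : 'I_n).

Definition l_minus : R := 1 / Delta.

Definition l_plus : R :=
  if Igt != finset.set0
  then (Num.sqrt (a i0) + Num.sqrt (d_ i0)) / (Delta * Num.sqrt (d_ i0))
  else 1 / Delta.

Definition cover_coef (i : 'I_n) : R :=
  Num.sqrt (a i) / (Num.sqrt (a i) - Num.sqrt (d_ i)).

Definition g_tilde (i : 'I_n) (x y : R) : R :=
  l_plus * a i * (Num.min x y - 1) + l_plus * Delta - 1.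

Definition h_tilde (i : 'I_n) (x y : R) : R :=
  l_minus * a i * (Num.min x y - 1).

Definition g_ (i : 'I_n) (x y : R) : R :=
  Num.sqrt (a i - Delta) * Num.sqrt (a i) * l_plus * Num.sqrt (x * y)
  - l_plus * (a i - Delta) - 1.

Definition h_ (i : 'I_n) (x y : R) : R :=
  cover_coef i * (Num.sqrt (x * y) - 1).

(* The final branch is reached, for i outside I, exactly when a i = 0. *)
Definition gamma_ (i : 'I_n) (x y : R) : R :=
  if i \in pos_part J0 then l_plus * a i * Num.min x y
  else if i \in neg_part J1 then - l_plus * a i * Num.min (2 - x - y) 1
  else if i \in neg_part J0 then
    Num.min (l_minus * a i * (x + y - 1))
      (Num.min (l_plus * a i * (x + y - 1) + l_plus * Delta - 1) 0)
  else if i \in pos_part J1 then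
    if (Igt != finset.set0) && (a i0 <= a i)
    then Num.min (Num.min (g_tilde i x y) (h_tilde i x y))
                 (Num.min (g_ i x y) (h_ i x y))
    else Num.min (g_tilde i x y) (h_tilde i x y)
  else 0.

End LiftedBilinearCover.

(* Main.v *)
Require Import Defs.
From HB Require Import structures.
From mathcomp Require Import all_boot all_order all_algebra.
From mathcomp Require Import all_classical all_reals all_analysis.
From mathcomp Require Import ring lra.
Set Implicit Arguments.
Unset Strict Implicit.
Unset Printing Implicit Defensive.
Import Order.TTheory GRing.Theory Num.Theory.
Local Open Scope ring_scope.

(** The terms of the inequality are all bounded below by one function of
one variable.  Write [D] for [Delta] and [L] for [l_plus], so that [L * D >= 1],
and let
  [psi u = min (max (u / D) (L * u)) (L * u + L * D - 1)],
which is [lifting_bound D L u]: piecewise linear with breakpoints [- D] and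
[0], of slope [1 / D] between them and of slope [L >= 1 / D] outside, with
[psi (- D) = -1].

For a point of the bilinear set, let [u i] be [a i * (x i * y i)] for [i] in
[J0] and [a i * (x i * y i - 1)] for [i] in [I] or [J1].  The constraint says
exactly that [\sum_i u i >= - D].  Two facts then give the inequality.
 - [psi] is subadditive ([lifting_bound_subadditive]) and nondecreasing, hence
   [\sum_i psi (u i) >= psi (\sum_i u i) >= psi (- D) = -1].
 - Each term of the inequality is at least [psi (u i)]
   ([lifting_bound_le_cover], [lifting_bound_le_gamma]).

For the second fact, [gamma_] is mostly a piece of [psi] composed with a
McCormick envelope of [x * y].  The terms with a square root are linear in
[t = sqrt (x * y)], whereas [t |-> psi (a i * (t ^+ 2 - 1))] is convex on each
side of [t = r / s], where [s = sqrt (a i)] and [r = sqrt (a i - D)]; there its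
value is [-1].  The functions [h_] and [g_] are the chords of the right and of
the left piece, and each also dominates the other piece as soon as [L] is large
enough ([lifting_bound_le_upper_chord], [lifting_bound_le_lower_chord]).  The
required size of [L] is largest at the smallest [a i > D], which is why [l_plus]
is defined from [i0] ([l_plus_steep]).

Concavity of [gamma_] holds because minima, nonnegative scalings and shifts
produce it from affine functions and the geometric mean ([gamma_concave]). *)

(** * Concave functions on the unit square *)

Local Notation square_concave R :=
  (concave_function (E := (R^o * R^o)%type) (@unit_square R)).

Section Concavity.
Context (R : realType).

Section Closure.
Context (E : lmodType R) (D : set (convex_lmodType E)).
Implicit Types f g : convex_lmodType E -> R^o.

(** The definition passes through the convexity of [- f]; clearing the signs
once keeps them out of the closure properties. *)
Lemma concave_functionP f :
  concave_function D f <->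
  forall (t : {i01 R}) (p q : convex_lmodType E), p \in D -> q \in D ->
    t%:num * f p + (1 - t%:num) * f q <= f (conv t p q).
Proof.
split=> [cf t p q Dp Dq|cf t p q Dp Dq].
  have := cf t p q Dp Dq; rewrite convRE.
  by rewrite !mulrN -opprD lerN2.
rewrite convRE !mulrN -opprD lerN2.
exact: cf.
Qed.

Lemma concave_ext f g : concave_function D g -> f =1 g -> concave_function D f.
Proof. by move=> + /funext ->. Qed.

Lemma concave_const c : concave_function D (fun=> c).
Proof. by apply/concave_functionP => t p q _ _; lra. Qed.

Lemma concave_min f g : concave_function D f -> concave_function D g ->
  concave_function D (fun p => Num.min (f p) (g p)).
Proof.
move=> /concave_functionP cf /concave_functionP cg.
apply/concave_functionP => t p q Dp Dq.
have t0 : 0 <= t%:num by [].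
have t1 : 0 <= 1 - t%:num by rewrite subr_ge0.
rewrite le_min; apply/andP; split.
  by apply: (le_trans _ (cf t p q Dp Dq)); rewrite lerD// ler_wpM2l// ge_min lexx.
by apply: (le_trans _ (cg t p q Dp Dq)); rewrite lerD// ler_wpM2l// ge_min lexx orbT.
Qed.

Lemma concave_scale_shift c b f : 0 <= c -> concave_function D f ->
  concave_function D (fun p => c * f p + b).
Proof.
move=> c0 /concave_functionP cf; apply/concave_functionP => t p q Dp Dq.
have := ler_wpM2l c0 (cf t p q Dp Dq); lra.
Qed.

End Closure.

Lemma concave_affine (b c e : R) :
  square_concave R (fun p => b * p.1 + c * p.2 + e).
Proof.
apply/concave_functionP => t [p1 p2] [q1 q2] _ _.
rewrite /= /GRing.scale /= /unstable.onem.
(* The coordinates live in [R^o]; linear arithmetic needs the single ring [R]. *)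
change (is_true (t%:num * (b * p1 + c * p2 + e)
    + (1 - t%:num) * (b * q1 + c * q2 + e)
  <= b * (t%:num * p1 + (1 - t%:num) * q1)
    + c * (t%:num * p2 + (1 - t%:num) * q2) + e :> R)).
lra.
Qed.

Lemma concave_min_coord : square_concave R (fun p => Num.min p.1 p.2).
Proof.
apply: concave_min.
- apply: (concave_ext (concave_affine 1 0 0)) => p.
  by rewrite mul1r mul0r !addr0.
- apply: (concave_ext (concave_affine 0 1 0)) => p.
  by rewrite mul1r mul0r add0r addr0.
Qed.

(** Cauchy-Schwarz for the vectors of square roots of the weighted
coordinates. *)
Lemma concave_sqrtM : square_concave R (fun p => Num.sqrt (p.1 * p.2)).
Proof.
apply/concave_functionP => t [p1 p2] [q1 q2].
rewrite !inE /unit_square /= !in_itv /= => -[/andP[p10 _] /andP[p20 _]] [/andP[q10 _] /andP[q20 _]].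
have t0 : 0 <= t%:num by [].
have t1 : 0 <= 1 - t%:num by rewrite subr_ge0.
rewrite /GRing.scale /= /unstable.onem.
move: (t%:num) t0 t1 => s s0 s1.
rewrite (sqrtrM p2 p10) (sqrtrM q2 q10).
set a := Num.sqrt p1; set b := Num.sqrt p2; set c := Num.sqrt q1; set e := Num.sqrt q2.
have a0 : 0 <= a by rewrite sqrtr_ge0.
have b0 : 0 <= b by rewrite sqrtr_ge0.
have c0 : 0 <= c by rewrite sqrtr_ge0.
have e0 : 0 <= e by rewrite sqrtr_ge0.
rewrite -(sqr_sqrtr p10) -(sqr_sqrtr p20) -(sqr_sqrtr q10) -(sqr_sqrtr q20) -/a -/b -/c -/e.
have L0 : 0 <= s * (a * b) + (1 - s) * (c * e).
  by rewrite addr_ge0// mulr_ge0// mulr_ge0.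
rewrite -(ger0_norm L0) -sqrtr_sqr ler_wsqrtr//.
(* The difference of the squares is [s * (1 - s) * (a * e - b * c) ^+ 2]. *)
rewrite -subr_ge0 [leRHS](_ : _ = s * (1 - s) * (a * e - b * c) ^+ 2); last by ring.
by rewrite mulr_ge0 ?sqr_ge0// mulr_ge0.
Qed.

End Concavity.

(** * The subadditive lower bound *)

Section LiftingBound.
Context (R : realType) (D L : R).
Hypotheses (D0 : 0 < D) (LD : 1 <= L * D).

(** The min-max form makes the function visibly a sublinear function capped by
one of its linear minorants shifted up by [L * D - 1], which is all that
subadditivity needs. *)
Definition lifting_bound (u : R) : R :=
  Num.min (Num.max (u / D) (L * u)) (L * u + L * D - 1).

Let L0 : 0 < L.
Proof. by rewrite -(pmulr_lgt0 _ D0); exact: lt_le_trans LD. Qed.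

Let LV : D^-1 <= L.
Proof. by rewrite -div1r ler_pdivrMr. Qed.

(** The maximum [p] is sublinear and [p w >= L * w].  If both terms on the right
are values of [p], sublinearity concludes; otherwise one of them is
[L * w + L * D - 1] and the other, whichever it is, is at least its linear part
because [L * D >= 1]; so the sum dominates [L * (u + v) + L * D - 1]. *)
Lemma lifting_bound_subadditive (u v : R) :
  lifting_bound (u + v) <= lifting_bound u + lifting_bound v.
Proof.
have p_sub : Num.max ((u + v) / D) (L * (u + v)) <=
    Num.max (u / D) (L * u) + Num.max (v / D) (L * v).
  rewrite ge_max mulrDl mulrDr; apply/andP; split.
    by rewrite lerD// le_max lexx.
  by rewrite lerD// le_max lexx orbT.
have pu : L * u <= Num.max (u / D) (L * u) by rewrite le_max lexx orbT.
have pv : L * v <= Num.max (v / D) (L * v) by rewrite le_max lexx orbT.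
rewrite /lifting_bound mulrDr in p_sub *.
move: (Num.max _ _) (Num.max _ _) (Num.max _ _) p_sub pu pv => qv qu q p_sub pu pv.
have c0 : 0 <= L * D - 1 by rewrite subr_ge0.
rewrite ge_min; apply/orP.
have [_|_] := leP qu (L * u + L * D - 1); have [_|_] := leP qv (L * v + L * D - 1).
- by left.
- by right; lra.
- by right; lra.
- by right; lra.
Qed.

Lemma lifting_bound0 : lifting_bound 0 = 0.
Proof.
by rewrite /lifting_bound mul0r mulr0 maxxx add0r min_l// subr_ge0.
Qed.

Lemma lifting_bound_sum (T : finType) (u : T -> R) :
  lifting_bound (\sum_i u i) <= \sum_i lifting_bound (u i).
Proof.
elim/big_ind2: _ => //; first by rewrite lifting_bound0.
by move=> v v' w w' hv hw; apply: (le_trans (lifting_bound_subadditive _ _)); exact: lerD.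
Qed.

Lemma lifting_bound_mono (u v : R) : u <= v -> lifting_bound u <= lifting_bound v.
Proof.
move=> uv; have Luv : L * u <= L * v by rewrite ler_pM2l.
have Duv : u / D <= v / D by rewrite ler_pM2r ?invr_gt0.
by rewrite /lifting_bound le_min2//; [exact: le_max2|lra].
Qed.

Lemma lifting_bound_neg (u : R) : u <= 0 ->
  lifting_bound u = Num.min (u / D) (L * u + L * D - 1).
Proof.
move=> u0; rewrite /lifting_bound [Num.max _ _]max_l//.
by rewrite mulrC ler_wnM2l.
Qed.

Lemma lifting_bound_pos (u : R) : 0 <= u -> lifting_bound u = L * u.
Proof.
move=> u0; rewrite /lifting_bound [Num.max _ _]max_r; last by rewrite [leRHS]mulrC ler_wpM2l.
by rewrite min_l// -addrA lerDl subr_ge0.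
Qed.

Lemma lifting_bound_le_slope (u : R) : u <= 0 -> lifting_bound u <= u / D.
Proof. by move=> u0; rewrite lifting_bound_neg// ge_min lexx. Qed.

Lemma lifting_bound_le_steep (u : R) : lifting_bound u <= L * u + L * D - 1.
Proof. by rewrite ge_min lexx orbT. Qed.

Lemma lifting_bound_ge_N1 (u : R) : - D <= u -> -1 <= lifting_bound u.
Proof.
move=> Du; have := lifting_bound_mono Du; apply: le_trans.
rewrite lifting_bound_neg; last by rewrite oppr_le0 ltW.
rewrite le_min mulNr divff ?gt_eqF// lexx /=; lra.
Qed.

(** Here [s] and [r] stand for the square roots of [A] and [A - D], where
[A >= D], and [t] for that of [x * y]. *)
Section Chords.
Context (r s t : R).
Hypotheses (r0 : 0 <= r) (rs : r < s) (rsD : s ^+ 2 - r ^+ 2 = D).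
Hypothesis (steep : 0 < r -> 1 <= L * r * (s - r)).
Hypotheses (t0 : 0 <= t) (t1 : t <= 1).

Let u := s ^+ 2 * (t ^+ 2 - 1).

Let u0 : u <= 0.
Proof. by rewrite mulr_ge0_le0 ?sqr_ge0// subr_le0 exprn_ile1. Qed.

Let sr0 : 0 < s - r.
Proof. by rewrite subr_gt0. Qed.

Let sr1 : 0 < s + r.
Proof. by rewrite ltr_wpDr// (le_lt_trans r0). Qed.

Let D_factor : D = (s - r) * (s + r).
Proof. by rewrite -rsD; ring. Qed.

(** The right side is the line through [-1] at [t = r / s] and [0] at
[t = 1].  Right of [r / s] the bound is the convex function [u / D] of [t],
which lies below this chord.  Left of [r / s] the bound is [L * (u + D) - 1],
again [-1] at [r / s]; dividing out the factor [s * t - r], the comparison is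
[L * (s * t + r) * (s - r) >= 1], which the steepness of [L] gives. *)
Lemma lifting_bound_le_upper_chord : lifting_bound u <= s / (s - r) * (t - 1).
Proof.
rewrite lifting_bound_neg// ge_min; apply/orP.
have [rst|srt] := leP r (s * t); [left|right].
  rewrite ler_pdivrMr// D_factor.
  rewrite [leRHS](_ : _ = s * (s + r) * (t - 1)); last by field; rewrite gt_eqF.
  rewrite /u -subr_ge0 [leRHS](_ : _ = s * (1 - t) * (s * t - r)); last by ring.
  by rewrite !mulr_ge0 ?subr_ge0// ltW// (le_lt_trans r0).
have rpos : 0 < r by rewrite (le_lt_trans _ srt)// mulr_ge0// ltW// (le_lt_trans r0).
rewrite -(ler_pM2r sr0).
rewrite [leRHS](_ : _ = s * (t - 1)); last by field; rewrite gt_eqF.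
have st0 : 0 <= s * t by rewrite mulr_ge0// ltW// (le_lt_trans r0).
have : 1 <= L * (s * t + r) * (s - r).
  apply: (le_trans (steep rpos)); rewrite ler_pM2r// ler_pM2l//; lra.
rewrite -rsD /u; nra.
Qed.

(** The right side is the line through [- L * r ^+ 2 - 1] at [t = 0] and
[-1] at [t = r / s], a chord of the convex function [L * (u + D) - 1].  Right of
[r / s] it is above the upper chord: both are [-1] at [r / s], and
steepness compares the slopes. *)
Lemma lifting_bound_le_lower_chord :
  0 < r -> lifting_bound u <= r * s * L * t - L * r ^+ 2 - 1.
Proof.
move=> rpos.
have [srt|rst] := leP (s * t) r.
  rewrite lifting_bound_neg// ge_min; apply/orP; right.
  rewrite -rsD /u -subr_ge0 [leRHS](_ : _ = L * (s * t) * (r - s * t)); last by ring.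
  by rewrite mulr_ge0 ?subr_ge0// mulr_ge0 ?(ltW L0)// mulr_ge0// ltW// (lt_trans rpos).
apply: (le_trans lifting_bound_le_upper_chord).
rewrite -(ler_pM2r sr0).
rewrite [leLHS](_ : _ = s * (t - 1)); last by field; rewrite gt_eqF.
have := steep rpos; nra.
Qed.

End Chords.

End LiftingBound.

(** * The cover data *)

Section Validity.
Context (R : realType) (n : nat) (a : 'I_n -> R) (d : R).
Context (I J0 J1 : {set 'I_n}) (i0 : 'I_n).
Hypothesis partI : minimal_cover_yielding_partition a d I J0 J1.
Hypothesis min_i0 : min_index a d I J1 i0.

Local Notation D := (Delta a d I J1).
Local Notation L := (l_plus a d I J1 i0).
Local Notation coef := (cover_coef a d I J1).

Lemma Delta_gt0 : 0 < D.
Proof. by case: partI => _ _ _ [_ _ h _]; rewrite /Delta subr_gt0. Qed.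

(** The cover is minimal: without [i] it no longer exceeds the demand. *)
Lemma Delta_le_cover i : i \in I -> D <= a i.
Proof.
move=> iI; case: partI => _ _ _ [_ _ _ /(_ (I :\ i)%SET)].
rewrite properD1// => /(_ isT).
by rewrite /Delta (big_setD1 i iI) /= => h; lra.
Qed.

Lemma Igt_min : Igt a d I J1 != finset.set0 ->
  D < a i0 /\ forall i, i \in Igt a d I J1 -> a i0 <= a i.
Proof. by move=> /min_i0[]; rewrite inE => /andP[_ ?]. Qed.

Lemma one_le_l_plusM : 1 <= L * D.
Proof.
rewrite /l_plus; case: ifPn => [/Igt_min[Di0 _]|_]; last first.
  by rewrite divfK// gt_eqF// Delta_gt0.
have d0 : 0 < Num.sqrt (d_ a d I J1 i0) by rewrite sqrtr_gt0 subr_gt0.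
rewrite [leRHS](_ : _ = (Num.sqrt (a i0) + Num.sqrt (d_ a d I J1 i0)) /
  Num.sqrt (d_ a d I J1 i0)); last first.
  by field; rewrite !gt_eqF// Delta_gt0.
by rewrite ler_pdivlMr// mul1r lerDr sqrtr_ge0.
Qed.

Lemma l_plus_gt0 : 0 < L.
Proof. by rewrite -(pmulr_lgt0 _ Delta_gt0) (lt_le_trans _ one_le_l_plusM). Qed.

(** With [s' = sqrt (a i0)] and [r' = sqrt (a i0 - D)], the factorization
[D = (s - r) * (s + r)] turns the right side into
[(s' + r') * r / (r' * (s + r))], so the claim is [r' * s <= r * s']: the
ratio [(b - D) / b] is nondecreasing in [b]. *)
Lemma l_plus_steep (b : R) : Igt a d I J1 != finset.set0 -> a i0 <= b ->
  1 <= L * Num.sqrt (b - D) * (Num.sqrt b - Num.sqrt (b - D)).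
Proof.
move=> Ine i0b; have [Di0 _] := Igt_min Ine.
have D0 := Delta_gt0.
rewrite /l_plus Ine /d_.
have bD : 0 < b - D by lra.
have aD : 0 < a i0 - D by lra.
have a0 : 0 < a i0 by lra.
have b0 : 0 < b by lra.
have rs_le : Num.sqrt (a i0 - D) * Num.sqrt b <= Num.sqrt (b - D) * Num.sqrt (a i0).
  rewrite -!sqrtrM ?(ltW aD) ?(ltW bD)//; apply: ler_wsqrtr; nra.
have := sqr_sqrtr (ltW bD); have := sqr_sqrtr (ltW b0).
have : 0 < Num.sqrt (b - D) by rewrite sqrtr_gt0.
have : 0 < Num.sqrt (a i0 - D) by rewrite sqrtr_gt0.
have : 0 < Num.sqrt b by rewrite sqrtr_gt0.
move: (Num.sqrt (b - D)) (Num.sqrt b) (Num.sqrt (a i0 - D)) (Num.sqrt (a i0)) rs_le.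
move=> r s r' s' rs_le s0 r'0 r0 sE rE.
have DE : D = (s - r) * (s + r) by rewrite -subr_sqr sE rE; ring.
have sr0 : 0 < s + r by rewrite addr_gt0.
have srN0 : s - r != 0 by apply/eqP => z; move: D0; rewrite DE z mul0r ltxx.
rewrite DE [leRHS](_ : _ = (s' + r') * r / (r' * (s + r))).
  rewrite ler_pdivlMr ?mulr_gt0//; lra.
by field; rewrite srN0 !gt_eqF.
Qed.

Lemma sqrt_shift_sqr (b : R) : D <= b ->
  Num.sqrt b ^+ 2 - Num.sqrt (b - D) ^+ 2 = D.
Proof.
move=> Db; have D0 := Delta_gt0.
by rewrite !sqr_sqrtr ?subr_ge0//; [ring | lra].
Qed.

Lemma sqrt_shift_lt (b : R) : D <= b -> Num.sqrt (b - D) < Num.sqrt b.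
Proof.
move=> Db; have D0 := Delta_gt0.
rewrite ltr_sqrt; lra.
Qed.

(** * Each term dominates the bound *)

Section OnePoint.
Context (x y : R).
Hypotheses (x0 : 0 <= x) (x1 : x <= 1) (y0 : 0 <= y) (y1 : y <= 1).

Let xy0 : 0 <= x * y. Proof. exact: mulr_ge0. Qed.
Let xy1 : x * y <= 1. Proof. by rewrite mulr_ile1. Qed.
Let t0 : 0 <= Num.sqrt (x * y). Proof. exact: sqrtr_ge0. Qed.
Let t1 : Num.sqrt (x * y) <= 1. Proof. by rewrite -sqrtr1 ler_wsqrtr. Qed.

Lemma mul_le_min : x * y <= Num.min x y.
Proof. by rewrite le_min ler_piMr// ler_piMl. Qed.

Lemma mccormick_le_mul : x + y - 1 <= x * y.
Proof.
have : 0 <= (1 - x) * (1 - y) by rewrite mulr_ge0// subr_ge0.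
lra.
Qed.

(** When [a i = D] the left piece of the chord argument is empty, so steepness
is required only for [D < a i]. *)
Lemma lifting_bound_le_h i : D <= a i ->
  (D < a i -> Igt a d I J1 != finset.set0 /\ a i0 <= a i) ->
  lifting_bound D L (a i * (x * y - 1)) <= h_ a d I J1 i x y.
Proof.
move=> Di steep.
have ai0 : 0 <= a i by rewrite (le_trans _ Di)// ltW// Delta_gt0.
rewrite /h_ /cover_coef /d_ -{1}(sqr_sqrtr ai0) -{1}(sqr_sqrtr xy0).
apply: lifting_bound_le_upper_chord => //.
- exact: Delta_gt0.
- exact: one_le_l_plusM.
- exact: sqrt_shift_lt.
- exact: sqrt_shift_sqr.
- by rewrite sqrtr_gt0 subr_gt0 => /steep[? ?]; exact: l_plus_steep.
Qed.

Lemma lifting_bound_le_g i : Igt a d I J1 != finset.set0 -> a i0 <= a i ->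
  lifting_bound D L (a i * (x * y - 1)) <= g_ a d I J1 i0 i x y.
Proof.
move=> Ine i0i; have [Di0 _] := Igt_min Ine; have Di := lt_le_trans Di0 i0i.
have ai0 : 0 <= a i by rewrite ltW// (lt_trans Delta_gt0).
rewrite /g_ -{1}(sqr_sqrtr ai0) -{1}(sqr_sqrtr xy0).
have aD0 : 0 <= a i - D by rewrite subr_ge0 ltW.
rewrite -{2}(sqr_sqrtr aD0).
apply: lifting_bound_le_lower_chord => //.
- exact: Delta_gt0.
- exact: one_le_l_plusM.
- exact/sqrt_shift_lt/ltW.
- exact/sqrt_shift_sqr/ltW.
- by move=> _; exact: l_plus_steep.
- by rewrite sqrtr_gt0 subr_gt0.
Qed.

Lemma lifting_bound_le_cover i : i \in I ->
  lifting_bound D L (a i * (x * y - 1)) <= coef i * (Num.sqrt (x * y) - 1).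
Proof.
move=> iI; apply: lifting_bound_le_h; first exact: Delta_le_cover.
move=> Di; have iIgt : i \in Igt a d I J1 by rewrite inE iI.
have Ine : Igt a d I J1 != finset.set0 by apply/set0Pn; exists i.
by split=> //; have [_] := Igt_min Ine; apply.
Qed.

(** The bound is nondecreasing, so [x * y] may be replaced by the McCormick
estimate on the side that the sign of [a i] asks for: [min x y] from above,
[max (x + y - 1) 0] from below. *)
Lemma lifting_bound_le_gamma i : i \notin I ->
  lifting_bound D L (a i * (x * y) - (if i \in J0 then 0 else a i))
    <= gamma_ a d I J0 J1 i0 i x y.
Proof.
move=> iI; have D0 := Delta_gt0; have LD := one_le_l_plusM; have L0 := l_plus_gt0.
have below_slope (u : R) v : a i * u <= 0 -> a i * u <= a i * v ->
    lifting_bound D L (a i * u) <= l_minus a d I J1 * a i * v.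
  move=> au0 uv; rewrite (le_trans (lifting_bound_le_slope D0 LD au0))//.
  by rewrite /l_minus div1r mulrC -mulrA ler_pM2l ?invr_gt0.
have below_steep (u : R) v : a i * u <= a i * v ->
    lifting_bound D L (a i * u) <= L * a i * v + L * D - 1.
  move=> uv; rewrite (le_trans (lifting_bound_le_steep _ _ _))//.
  by rewrite lerD2r lerD2r -mulrA ler_pM2l.
have xyb := mul_le_min; have xyl := mccormick_le_mul.
rewrite /gamma_ /pos_part /neg_part !inE.
have [iJ0|iJ0] := boolP (i \in J0).
  have iJ1 : i \notin J1.
    by case: partI => _ [_ _ dis] _ _; rewrite (disjointFr dis iJ0).
  rewrite (negbTE iJ1) /= subr0; have [ai|ai|ai] := ltgtP 0 (a i).
  - rewrite lifting_bound_pos ?mulr_ge0 ?(ltW ai)//.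
    by rewrite -mulrA ler_pM2l// ler_pM2l.
  - have axy0 : a i * (x * y) <= 0 by rewrite mulr_le0_ge0// ltW.
    have axy : a i * (x * y) <= a i * (x + y - 1) by rewrite ler_nM2l.
    rewrite le_min le_min below_slope// below_steep//=.
    by rewrite -(lifting_bound0 LD) lifting_bound_mono.
  - by rewrite -ai mul0r lifting_bound0.
have iJ1 : i \in J1.
  case: partI => + _ _ _ => /setP/(_ i).
  by rewrite !inE (negbTE iI) (negbTE iJ0).
have -> : a i * (x * y) - a i = a i * (x * y - 1) by ring.
rewrite iJ1 /=; have [ai|ai|ai] := ltgtP 0 (a i).
- have axy0 : a i * (x * y - 1) <= 0 by rewrite mulr_ge0_le0 ?(ltW ai)// subr_le0.
  have axy : a i * (x * y - 1) <= a i * (Num.min x y - 1).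
    by rewrite ler_pM2l// lerD2r.
  have tildes : lifting_bound D L (a i * (x * y - 1)) <=
      Num.min (g_tilde a d I J1 i0 i x y) (h_tilde a d I J1 i x y).
    by rewrite le_min below_steep ?below_slope.
  case: ifP => // /andP[Ine i0i].
  rewrite le_min tildes /= le_min lifting_bound_le_g//= lifting_bound_le_h//.
  by have [Di0 _] := Igt_min Ine; exact/ltW/(lt_le_trans Di0).
- rewrite lifting_bound_pos//; last by rewrite mulr_le0// ?(ltW ai)// subr_le0.
  rewrite !mulNr -mulrN -mulrA ler_pM2l// ler_nM2l//.
  have : 1 - x * y <= Num.min (2 - x - y) 1 by rewrite le_min gerBl xy0 andbT; lra.
  lra.
- by rewrite -ai mul0r lifting_bound0.
Qed.

End OnePoint.

(** * Validity and concavity *)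

Lemma lifted_inequality x y : bilinear_cover_set a d (x, y) ->
  -1 <= \sum_(i in I) coef i * (Num.sqrt (x i * y i) - 1)
        + \sum_(i | i \notin I) gamma_ a d I J0 J1 i0 i (x i) (y i).
Proof.
rewrite /bilinear_cover_set /= => -[sq dxy].
have {}sq i : [/\ 0 <= x i, x i <= 1, 0 <= y i & y i <= 1].
  have [] := sq i; rewrite /= !in_itv /=.
  by move=> /andP[? ?] /andP[? ?].
case: (partI) => cover [IJ0 IJ1 J01] _ _.
pose c i := if i \in J0 then 0 else a i.
have sumc : \sum_(i in I) a i + \sum_(i in J1) a i = \sum_i c i.
  rewrite [X in X + _]big_mkcond [X in _ + X]big_mkcond -big_split /=.
  apply: eq_bigr => i _; rewrite /c.
  move/setP/(_ i): (cover); rewrite !inE.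
  have [iI|iI] := boolP (i \in I); first by rewrite (disjointFr IJ0) ?(disjointFr IJ1)// addr0.
  have [iJ0|iJ0] := boolP (i \in J0); first by rewrite (disjointFr J01)// addr0.
  by rewrite /= => ->; rewrite add0r.
pose u i := a i * (x i * y i) - c i.
have DE : - D <= \sum_i u i.
  rewrite sumrB -sumc /Delta /dLambda.
  have -> : \sum_i a i * (x i * y i) = \sum_i a i * x i * y i.
    by apply: eq_bigr => i _; rewrite mulrA.
  lra.
apply: (le_trans (lifting_bound_ge_N1 Delta_gt0 one_le_l_plusM DE)).
apply: (le_trans (lifting_bound_sum one_le_l_plusM _)).
rewrite (bigID (mem I)) /=; apply: lerD; apply: ler_sum => i iI;
  have [xi0 xi1 yi0 yi1] := sq i.
  have -> : u i = a i * (x i * y i - 1).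
    by rewrite /u /c (disjointFr IJ0)// mulrBr mulr1.
  exact: lifting_bound_le_cover.
exact: lifting_bound_le_gamma.
Qed.

Lemma gamma_concave i :
  square_concave R (fun p => gamma_ a d I J0 J1 i0 i p.1 p.2).
Proof.
have D0 := Delta_gt0; have L0 := l_plus_gt0.
have lm0 : 0 <= l_minus a d I J1 by rewrite /l_minus div1r invr_ge0 ltW.
rewrite /gamma_.
have [/[!inE]/andP[_ ai]|_] := boolP (i \in pos_part a J0).
  have c0 : 0 <= L * a i by rewrite mulr_ge0// ltW.
  apply: (concave_ext (concave_scale_shift 0 c0 (@concave_min_coord R))) => p.
  by rewrite addr0.
have [/[!inE]/andP[_ ai]|_] := boolP (i \in neg_part a J1).
  have c0 : 0 <= - L * a i by rewrite mulr_le0// ?oppr_le0 ltW.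
  have min_concave : square_concave R (fun p => Num.min (2 - p.1 - p.2) 1).
    apply: concave_min; last exact: concave_const.
    by apply: (concave_ext (concave_affine (-1) (-1) 2)) => p; ring.
  apply: (concave_ext (concave_scale_shift 0 c0 min_concave)) => p.
  by rewrite addr0.
have [_|_] := boolP (i \in neg_part a J0).
  apply: concave_min; last apply: concave_min; last exact: concave_const.
  - set k := l_minus _ _ _ _ * _.
    by apply: (concave_ext (concave_affine k k (- k))) => p; ring.
  - set k := L * a i.
    by apply: (concave_ext (concave_affine k k (- k + L * D - 1))) => p; ring.
have [/[!inE]/andP[_ ai]|_] := boolP (i \in pos_part a J1); last first.
  exact: concave_const.
have tildes : square_concave R (fun p =>
    Num.min (g_tilde a d I J1 i0 i p.1 p.2) (h_tilde a d I J1 i p.1 p.2)).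
  have cp : 0 <= L * a i by rewrite mulr_ge0// ltW.
  have cm : 0 <= l_minus a d I J1 * a i by rewrite mulr_ge0// ltW.
  apply: concave_min.
  - apply: (concave_ext (concave_scale_shift (- (L * a i) + L * D - 1) cp
      (@concave_min_coord R))) => p.
    by rewrite /g_tilde; ring.
  - apply: (concave_ext (concave_scale_shift (- (l_minus a d I J1 * a i)) cm
      (@concave_min_coord R))) => p.
    by rewrite /h_tilde; ring.
have [/andP[Ine i0i]|_] // := boolP ((Igt a d I J1 != finset.set0) && (a i0 <= a i)).
have [Di0 _] := Igt_min Ine.
have Di : D <= a i by rewrite ltW// (lt_le_trans Di0).
have cg : 0 <= Num.sqrt (a i - D) * Num.sqrt (a i) * L.
  by rewrite !mulr_ge0// ?sqrtr_ge0// ltW.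
have ch : 0 <= coef i.
  by rewrite /cover_coef divr_ge0 ?sqrtr_ge0// subr_ge0 ltW// sqrt_shift_lt.
apply: concave_min => //; apply: concave_min.
- apply: (concave_ext (concave_scale_shift (- (L * (a i - D)) - 1) cg
    (@concave_sqrtM R))) => p.
  by rewrite /g_ addrA.
- apply: (concave_ext (concave_scale_shift (- coef i) ch (@concave_sqrtM R))) => p.
  by rewrite /h_ mulrBr mulr1.
Qed.

End Validity.

Theorem theorem6 (R : realType) (n : nat) (a : 'I_n -> R) (d : R)
    (I J0 J1 : {set 'I_n}) (i0 : 'I_n) :
  minimal_cover_yielding_partition a d I J0 J1 ->
  min_index a d I J1 i0 ->
  (forall i, i \notin I ->
     concave_function (E := (R^o * R^o)%type) (@unit_square R)
       (fun p => gamma_ a d I J0 J1 i0 i p.1 p.2)) /\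
  (forall x y : 'I_n -> R, bilinear_cover_set a d (x, y) ->
     \sum_(i in I) cover_coef a d I J1 i * (Num.sqrt (x i * y i) - 1)
     + \sum_(i | i \notin I) gamma_ a d I J0 J1 i0 i (x i) (y i) >= -1).
Proof.
move=> partI min_i0; split=> [i _|x y xyQ].
  exact: gamma_concave.
exact: lifted_inequality.
Qed.
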